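(* Let $V$ be a finitely generated $\mathcal F$-representation. Then $\dim V[n]$ coincides with a polynomial in $n$ for all $n\ge 1$. Indeed, for $n\ge 1$, $$\dim V[n]=\varphi_V(n,n,n,n,\dots),$$ where $\varphi_V$ is the universal trace-computing polynomial of $V$.
   Context: $\mathcal F$ is the category with objects the finite sets $[k]=\{1,\dots,k\}$, $k\ge 0$, and all functions as morphisms. $\mathcal V$ is the category of finite-dimensional $\mathbb Q$-vector spaces. An $\mathcal F$-representation is a functor $V:\mathcal F\to\mathcal V$; $Vf$ denotes the linear map induced by a function $f$. For $k\ge0$ let $\otimes^k:\mathcal F\to\mathcal V$ be the functor sending $X$ to the free $\mathbb Q$-vector space on the set of functions $[k]\to X$ (with $\mathcal F$ acting by postcomposition). $V$ is finitely generated if there is a surjection onto $V$ from a finite direct sum of functors $\otimes^{k}$ (various $k$). A universal trace-computing polynomial of $V$ is a polynomial $\varphi_V(x_0,x_1,x_2,\dots)$ over $\mathbb Q$ (in finitely many of the variables) such that for every $n>0$ and every function $f$ from a set of size $n$ to itself, $\operatorname{Tr}(Vf)=\varphi_V(n,a_1,a_2,\dots)$, where $a_i$ is the number of fixed points of the $i$-th iterate $f^i$. The existence of such a polynomial for every finitely generated $V$ is part of what is asserted in the paper (a companion result). *)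

(* Defs.v *)
From HB Require Import structures.
From mathcomp Require Import all_boot all_order all_algebra.
From mathcomp Require Import mpoly.

Set Implicit Arguments.
Unset Strict Implicit.
Unset Printing Implicit Defensive.

Import GRing.Theory.
Local Open Scope ring_scope.

(* The object [n] = {1, ..., n} of the category F is 'I_n (so it is numbered
   from 0), and a morphism [m] -> [n] is an element of {ffun 'I_m -> 'I_n}. *)
Definition ffid n : {ffun 'I_n -> 'I_n} := [ffun x => x].
Definition ffcomp m n p (g : {ffun 'I_n -> 'I_p}) (f : {ffun 'I_m -> 'I_n}) :
  {ffun 'I_m -> 'I_p} := [ffun x => g (f x)].

Record Frep := MkFrep {
  Fobj :> nat -> vectType rat;
  Fmap : forall m n, {ffun 'I_m -> 'I_n} -> 'Hom(Fobj m, Fobj n);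
  Fmap_id : forall n, Fmap (ffid n) = \1%VF;
  Fmap_comp : forall m n p (g : {ffun 'I_n -> 'I_p}) (f : {ffun 'I_m -> 'I_n}),
    Fmap (ffcomp g f) = (Fmap g \o Fmap f)%VF
}.

Definition natural (V W : Frep) (eta : forall n, 'Hom(V n, W n)) : Prop :=
  forall m n (f : {ffun 'I_m -> 'I_n}),
    (eta n \o Fmap V f = Fmap W f \o eta m)%VF.

(* In the functor category an epimorphism is a natural transformation all of
   whose components are surjective. *)
Definition surjects_onto (W V : Frep) : Prop :=
  exists eta : forall n, 'Hom(W n, V n),
    natural eta /\ forall n, limg (eta n) = fullv.

Section TensorPower.
Variable k : nat.

(* A function v : {ffun {ffun 'I_k -> 'I_n} -> rat^o} stands for the formal
   sum of the v h * [h]; [f] sends the basis vector [h] to [f o h]. *)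
Definition tens_obj (n : nat) : vectType rat :=
  {ffun {ffun 'I_k -> 'I_n} -> rat^o}.

Definition tens_fun m n (f : {ffun 'I_m -> 'I_n}) (v : tens_obj m) :
  tens_obj n := [ffun h => \sum_(g | ffcomp f g == h) v g].

Lemma tens_fun_is_linear m n (f : {ffun 'I_m -> 'I_n}) : linear (tens_fun f).
Proof.
move=> a u v; apply/ffunP=> h; rewrite !ffunE scaler_sumr -big_split.
by apply: eq_bigr => g _; rewrite !ffunE.
Qed.

HB.instance Definition _ m n (f : {ffun 'I_m -> 'I_n}) :=
  GRing.isLinear.Build rat (tens_obj m) (tens_obj n) *:%R (tens_fun f)
    (tens_fun_is_linear f).

Definition tens_map m n (f : {ffun 'I_m -> 'I_n}) :
  'Hom(tens_obj m, tens_obj n) := linfun (tens_fun f).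

Lemma tens_map_id n : tens_map (ffid n) = \1%VF.
Proof.
apply/lfunP=> v; rewrite !lfunE; apply/ffunP=> h; rewrite ffunE.
rewrite (big_pred1 h) // => g; congr (_ == h).
by apply/ffunP=> x; rewrite !ffunE.
Qed.

Lemma tens_map_comp m n p (g : {ffun 'I_n -> 'I_p}) (f : {ffun 'I_m -> 'I_n}) :
  tens_map (ffcomp g f) = (tens_map g \o tens_map f)%VF.
Proof.
apply/lfunP=> v; rewrite comp_lfunE !lfunE; apply/ffunP=> h; rewrite !ffunE.
have ffA e : ffcomp (ffcomp g f) e = ffcomp g (ffcomp f e).
  by apply/ffunP=> x; rewrite !ffunE.
rewrite (partition_big (ffcomp f) (fun h' => ffcomp g h' == h)) /=.
  apply: eq_bigr => h' /eqP gh'; rewrite ffunE; apply: eq_bigl => e.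
  by rewrite ffA; case: (ffcomp f e =P h') => [->|_]; rewrite ?andbF ?gh' ?eqxx.
by move=> e; rewrite ffA.
Qed.

Definition tens : Frep := MkFrep tens_map_id tens_map_comp.
End TensorPower.

Section Sum.
Variables V W : Frep.

Definition fsum_obj (n : nat) : vectType rat := (V n * W n)%type.

Definition fsum_fun m n (f : {ffun 'I_m -> 'I_n}) (v : fsum_obj m) :
  fsum_obj n := (Fmap V f v.1, Fmap W f v.2).

Lemma fsum_fun_is_linear m n (f : {ffun 'I_m -> 'I_n}) : linear (fsum_fun f).
Proof. by move=> a u v; rewrite /fsum_fun /= !linearP. Qed.

HB.instance Definition _ m n (f : {ffun 'I_m -> 'I_n}) :=
  GRing.isLinear.Build rat (fsum_obj m) (fsum_obj n) *:%R (fsum_fun f)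
    (fsum_fun_is_linear f).

Definition fsum_map m n (f : {ffun 'I_m -> 'I_n}) :
  'Hom(fsum_obj m, fsum_obj n) := linfun (fsum_fun f).

Lemma fsum_map_id n : fsum_map (ffid n) = \1%VF.
Proof.
by apply/lfunP=> -[v w]; rewrite !lfunE /= /fsum_fun !Fmap_id !lfunE.
Qed.

Lemma fsum_map_comp m n p (g : {ffun 'I_n -> 'I_p}) (f : {ffun 'I_m -> 'I_n}) :
  fsum_map (ffcomp g f) = (fsum_map g \o fsum_map f)%VF.
Proof.
apply/lfunP=> -[v w]; rewrite comp_lfunE !lfunE /= /fsum_fun !Fmap_comp.
by rewrite !comp_lfunE.
Qed.

Definition fsum : Frep := MkFrep fsum_map_id fsum_map_comp.
End Sum.

Definition fzero_obj (n : nat) : vectType rat := 'rV[rat]_0.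
Definition fzero_map m n (f : {ffun 'I_m -> 'I_n}) :
  'Hom(fzero_obj m, fzero_obj n) := 0.

Lemma fzero_map_id n : fzero_map (ffid n) = \1%VF.
Proof. by apply/lfunP=> v; apply/rowP; case. Qed.

Lemma fzero_map_comp m n p (g : {ffun 'I_n -> 'I_p})
  (f : {ffun 'I_m -> 'I_n}) :
  fzero_map (ffcomp g f) = (fzero_map g \o fzero_map f)%VF.
Proof. by rewrite /fzero_map comp_lfun0l. Qed.

Definition fzero : Frep := MkFrep fzero_map_id fzero_map_comp.

Definition tens_sum (ks : seq nat) : Frep :=
  foldr (fun k W => fsum (tens k) W) fzero ks.

Definition finitely_generated (V : Frep) : Prop :=
  exists ks : seq nat, surjects_onto (tens_sum ks) V.

Definition lftrace (vT : vectType rat) (u : 'End(vT)) : rat :=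
  \tr (passmx.mxof (vbasis {:vT}) (vbasis {:vT}) u).

Definition nfix n (f : {ffun 'I_n -> 'I_n}) (i : nat) : nat :=
  #|[set x | iter i f x == x]|.

(* The values (n, a_1, a_2, ...) of (x_0, x_1, x_2, ...) at f. *)
Definition trace_point n (f : {ffun 'I_n -> 'I_n}) (i : nat) : rat :=
  if i is 0 then n%:R else (nfix f i)%:R.

(* A polynomial in finitely many of the variables x_0, x_1, ... is an element
   of {mpoly rat[N]} for some N, with x_i being 'X_i for i < N. *)
Definition universal_trace_poly (V : Frep) N (phi : {mpoly rat[N]}) : Prop :=
  forall n (f : {ffun 'I_n -> 'I_n}), (0 < n)%N ->
    lftrace (Fmap V f) = phi.@[fun i : 'I_N => trace_point f i].

(* Main.v *)
Require Import Defs.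
From mathcomp Require Import all_boot all_order all_algebra.
From mathcomp Require Import mpoly fingroup perm.

Set Implicit Arguments.
Unset Strict Implicit.
Unset Printing Implicit Defensive.

Import GRing.Theory Num.Theory passmx.
Local Open Scope ring_scope.

(** Why the theorem holds.  Everything about [V] that matters is the function
    t(f) = Tr(V f) on self-maps of finite sets.  It satisfies t(gf) = t(fg),
    and it has finite degree: if [V] is a quotient of a sum of the tensor
    functors of order at most [K], then any combination of maps that acts as 0
    on those functors acts as 0 on [V], so t vanishes on it.  The combinations
    used are alternating sums over the subsets [T] of a set with more than [K]
    elements, of maps u_T such that every point sees at most one element of
    [T]: a function from at most [K] points misses some element, and switching
    that element in and out of [T] cancels the terms in pairs
    ([frep_trace_degree_le]).

    Let f fix a point x0.  Mapping the complement of [T] to x0 gives commuting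
    idempotents, and Moebius inversion over the subsets writes t(f) as the sum
    of the cross effects w(f, S), where [S] avoids x0 ([cross_effect_sum]).
    The degree bound gives w(f, S) = 0 for |S| > K; cyclicity of t gives
    w(f, S) = 0 unless f permutes [S] ([cross_effect_unstable]), and shows that
    w(f, S) depends only on the conjugacy class of the permutation f|S
    ([cross_effect_inj]).  For a permutation s of k points, let N_s(f) be the
    number of maps h from k points such that f h = h s.  Such an h is determined
    by one image for each cycle of s, a fixed point of the iterate of f whose
    exponent is the length of the cycle; hence N_s is a monomial in the a_i
    ([equiv_count_prod]).  The cross effects of N_s vanish on sets of more than
    k points and, on sets of k points, count the bijections that conjugate s to
    f|S ([cross_effect_equiv_count]).  So subtracting from t the average over s
    of w(s) N_s kills the cross effects of size k, and by induction
    t is a polynomial in the a_i on all maps with a fixed point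
    ([pointed_poly]).

    If f has no fixed point but acts on a nonempty set, add K + 1 new points,
    keeping those in [T] fixed and sending the others where f sends some chosen
    x0.  The alternating sum of t over [T] is zero; its term for the empty [T]
    is t(f), and all the other maps have fixed points ([trace_poly]).

    The statements on dimensions follow by taking f to be the identity. *)

(** * Traces of endomorphisms *)

Lemma lftraceZ (U : vectType rat) (a : rat) (f : 'End(U)) :
  lftrace (a *: f) = a * lftrace f.
Proof. by rewrite /lftrace linearZ mxtraceZ. Qed.

Lemma lftrace_sum (U : vectType rat) (J : finType) (F : J -> 'End(U)) :
  lftrace (\sum_j F j) = \sum_j lftrace (F j).
Proof. by rewrite /lftrace !raddf_sum. Qed.

Lemma lftrace_compC (U W : vectType rat) (f : 'Hom(U, W)) (g : 'Hom(W, U)) :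
  lftrace (g \o f)%VF = lftrace (f \o g)%VF.
Proof. by rewrite /lftrace !(mxof_comp _ _ (vbasisP _)) mxtrace_mulC. Qed.

Lemma lftrace_id (U : vectType rat) :
  lftrace (\1%VF : 'End(U)) = (\dim {:U})%:R.
Proof. by rewrite /lftrace mxof1 ?mxtrace1 ?(basis_free (vbasisP _)). Qed.

(** * Cyclic functions of finite degree on self-maps *)

(** The source of every cancellation below: pair [T] with [T] plus [y]. *)
Lemma alt_sum_eq0 (Y : finType) (S : {set Y}) (y : Y) (G : {set Y} -> rat) :
    y \in S ->
    (forall T : {set Y}, T \subset S -> y \notin T -> G (y |: T) = G T) ->
  \sum_(T : {set Y} | T \subset S) (-1) ^+ #|T| * G T = 0.
Proof.
move=> yS GyT; rewrite (bigID (fun T : {set Y} => y \in T)) /=.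
rewrite (reindex_onto (fun T : {set Y} => y |: T) (fun T => T :\ y)) /=;
  last first.
  by move=> T /andP[_ yT]; rewrite setD1K.
rewrite (eq_bigl (fun T : {set Y} => (T \subset S) && (y \notin T)));
  last first.
  move=> T; rewrite subUset sub1set yS setU11 andbT /=; congr (_ && _).
  by apply/eqP/idP => [<-|yT]; rewrite ?setD11 // setU1K.
rewrite -big_split big1 //= => T /andP[TS yT].
by rewrite cardsU1 yT add1n exprS mulN1r GyT // mulNr addNr.
Qed.

Definition endo_fun := forall X : finType, (X -> X) -> rat.

Record trace_like (t : endo_fun) : Prop := TraceLike {
  trace_ext : forall (X : finType) (f g : X -> X), f =1 g -> t X f = t X g;
  trace_cyc : forall (X Y : finType) (f : X -> Y) (g : Y -> X),
    t X (g \o f) = t Y (f \o g)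
}.

(** A function has degree at most [K] when it is killed by the alternating sums
    over families in which the value of u_T at x depends only on whether the
    single element [p x] belongs to [T].  These families contain both the
    collapsing of points to a base point ([retract]) and the adjunction of new
    points ([adjoin]). *)
Definition degree_le K (t : endo_fun) : Prop :=
  forall (X Y : finType) (S : {set Y}) (u : {set Y} -> X -> X)
         (p : X -> option Y),
    (forall (T : {set Y}) y x, T \subset S -> y \in S -> y \notin T ->
       p x != Some y -> u (y |: T) x = u T x) ->
    (K < #|S|)%N ->
  \sum_(T : {set Y} | T \subset S) (-1) ^+ #|T| * t X (u T) = 0.

(** * The trace function of a functor *)

(** Numbering the elements transports maps of arbitrary finite sets to maps of
    standard ones; by cyclicity of the trace the numbering chosen does not
    matter ([frep_trace_ord]). *)
Definition on_ord (X Y : finType) (f : X -> Y) : {ffun 'I_#|X| -> 'I_#|Y|} :=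
  [ffun i => enum_rank (f (enum_val i))].

Definition frep_trace (V : Frep) (X : finType) (f : X -> X) : rat :=
  lftrace (Fmap V (on_ord f)).

Lemma on_ord_comp (X Y Z : finType) (g : Y -> Z) (f : X -> Y) :
  on_ord (g \o f) = ffcomp (on_ord g) (on_ord f).
Proof. by apply/ffunP=> i; rewrite !ffunE /= enum_rankK. Qed.

Lemma frep_trace_like V : trace_like (frep_trace V).
Proof.
split=> [X f g fg|X Y f g]; rewrite /frep_trace.
  by congr (lftrace (Fmap V _)); apply/ffunP=> i; rewrite !ffunE fg.
by rewrite (on_ord_comp g f) (on_ord_comp f g) !Fmap_comp lftrace_compC.
Qed.

Lemma frep_trace_ord V n (f : {ffun 'I_n -> 'I_n}) :
  frep_trace V f = lftrace (Fmap V f).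
Proof.
pose a : {ffun 'I_n -> 'I_#|'I_n|} := [ffun i => enum_rank i].
pose b : {ffun 'I_#|'I_n| -> 'I_n} := [ffun i => enum_val i].
have -> : lftrace (Fmap V f) =
    lftrace (Fmap V (ffcomp b (ffcomp (on_ord f) a))).
  by congr (lftrace (Fmap V _)); apply/ffunP=> i; rewrite !ffunE !enum_rankK.
rewrite Fmap_comp lftrace_compC -Fmap_comp /frep_trace.
by congr (lftrace (Fmap V _)); apply/ffunP=> i; rewrite !ffunE enum_valK.
Qed.

(** A combination of maps is a relation if it acts as 0 on the basis vectors of
    the tensor functors of order at most [K]; it then acts as 0 on all quotients
    of sums of these functors. *)
Section Relations.
Variables (J : finType) (c : J -> rat) (m n K : nat).
Variable g : J -> {ffun 'I_m -> 'I_n}.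
Hypothesis g_rel : forall k (h0 : {ffun 'I_k -> 'I_m}) h, (k <= K)%N ->
  \sum_(j | ffcomp (g j) h0 == h) c j = 0.

Lemma tens_relation k : (k <= K)%N -> \sum_j c j *: Fmap (tens k) (g j) = 0.
Proof.
move=> kK; apply/lfunP=> v; rewrite sum_lfunE zero_lfunE; apply/ffunP=> h.
rewrite sum_ffunE ffunE.
under eq_bigr => j _ do rewrite scale_lfunE lfunE !ffunE big_mkcond scaler_sumr.
rewrite exchange_big /= big1 // => h0 _.
transitivity ((\sum_(j | ffcomp (g j) h0 == h) c j) * v h0).
  rewrite mulr_suml [RHS]big_mkcond; apply: eq_bigr => j _.
  by case: ifP => _; rewrite ?scaler0.
by rewrite g_rel ?mul0r.
Qed.

Lemma tens_sum_relation ks : {in ks, forall k, k <= K}%N ->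
  \sum_j c j *: Fmap (tens_sum ks) (g j) = 0.
Proof.
elim: ks => [_|k ks IHks kK]; first by apply/lfunP=> v; apply/rowP; case.
have Ek : \sum_j c j *: Fmap (tens k) (g j) = 0.
  by apply/tens_relation/kK/mem_head.
have {IHks}Eks : \sum_j c j *: Fmap (tens_sum ks) (g j) = 0.
  by apply: IHks => i iks; apply: kK; rewrite inE iks orbT.
have eval (W : Frep) (x : W m) : \sum_j c j *: Fmap W (g j) = 0 ->
    \sum_j c j *: Fmap W (g j) x = 0.
  move=> /(congr1 (fun z : 'Hom(_, _) => z x)).
  by rewrite sum_lfunE zero_lfunE; under eq_bigr => j _ do rewrite scale_lfunE.
apply/lfunP=> -[v w]; rewrite sum_lfunE zero_lfunE.
under eq_bigr => j _ do rewrite scale_lfunE lfunE /= /fsum_fun /=.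
rewrite [LHS]surjective_pairing (raddf_sum fst) (raddf_sum snd) /=.
by rewrite (eval _ v Ek) (eval _ w Eks).
Qed.

Lemma quotient_relation ks V : surjects_onto (tens_sum ks) V ->
  {in ks, forall k, k <= K}%N -> \sum_j c j *: Fmap V (g j) = 0.
Proof.
move=> [eta [eta_nat eta_surj]] /tens_sum_relation E; apply/lfunP=> v.
have /memv_imgP[w _ ->] : v \in limg (eta m) by rewrite eta_surj memvf.
transitivity (eta n ((\sum_j c j *: Fmap (tens_sum ks) (g j)) w)).
  rewrite !sum_lfunE linear_sum; apply: eq_bigr => j _.
  rewrite !scale_lfunE linearZ; congr (_ *: _).
  by rewrite -[LHS]comp_lfunE -eta_nat comp_lfunE.
by rewrite E !zero_lfunE linear0.
Qed.
End Relations.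

(** The combination of the V u_T has signs on the subsets of [S]; on a basis
    vector h0 it cancels because h0, having at most [K] < |S| entries, misses
    some y in [S]. *)
Lemma frep_trace_degree_le V ks K : surjects_onto (tens_sum ks) V ->
  {in ks, forall k, k <= K}%N -> degree_le K (frep_trace V).
Proof.
move=> V_quot ksK X Y S u p u_loc ltKS.
pose c (T : {set Y}) : rat := if T \subset S then (-1) ^+ #|T| else 0.
have E : \sum_T c T *: Fmap V (on_ord (u T)) = 0.
  apply: (quotient_relation _ V_quot ksK) => k h0 h kK.
  have [y yS /forallP py] :
      exists2 y, y \in S & [forall i, p (enum_val (h0 i)) != Some y].
    apply/exists_inP; apply: contraLR ltKS; rewrite negb_exists_in -leqNgt.
    move=> /forall_inP/= nS; apply: leq_trans kK.
    rewrite -[k in (_ <= k)%N]card_ord.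
    rewrite -(card_imset (fun y : Y => y \in S) (@Some_inj _)).
    apply: leq_trans (leq_image_card (fun i => p (enum_val (h0 i))) predT).
    apply/subset_leq_card/subsetP=> _ /imsetP[y /nS yP ->].
    move: yP; rewrite negb_forall => /existsP[i]; rewrite negbK => /eqP <-.
    exact: (image_f (fun i => p (enum_val (h0 i)))).
  pose G T : rat := (ffcomp (on_ord (u T)) h0 == h)%:R.
  apply: etrans (alt_sum_eq0 (S := S) (G := G) yS _).
    rewrite [LHS]big_mkcond [RHS]big_mkcond; apply: eq_bigr => T _.
    rewrite /c /G.
    by case: ifP; case: ifP; rewrite ?mulr1 ?mulr0.
  move=> T TS yT; congr (_ == h)%:R; apply/ffunP=> i; rewrite !ffunE.
  by rewrite (u_loc _ _ _ TS yS yT (py i)).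
have := congr1 (@lftrace _) E; rewrite lftrace_sum.
have -> : lftrace (0 : 'End(V #|X|)) = 0 by rewrite -(scale0r 0) lftraceZ mul0r.
apply: etrans; rewrite big_mkcond; apply: eq_bigr => T _; rewrite lftraceZ /c.
by case: ifP; rewrite ?mul0r.
Qed.

(** * Cross effects at a fixed point *)
Definition retract (X : finType) (x0 : X) (T : {set X}) (x : X) : X :=
  if x \in T then x else x0.

Lemma retractI (X : finType) (x0 : X) (A B : {set X}) :
  retract x0 A \o retract x0 B =1 retract x0 (A :&: B).
Proof.
move=> x; rewrite /retract /= inE.
by case: (x \in B); rewrite ?andbF ?andbT // if_same.
Qed.

Section CrossEffects.
Variable t : endo_fun.

Definition cross_effect (X : finType) (x0 : X) (f : X -> X)
    (S : {set X}) : rat :=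
  (-1) ^+ #|S| *
  \sum_(T : {set X} | T \subset S) (-1) ^+ #|T| * t (f \o retract x0 T).

(** Moebius inversion on the lattice of subsets: the alternating sum of the
    signs over the sets between [T] and [A] vanishes unless [T] = [A]. *)
Lemma cross_effect_sum (X : finType) (x0 : X) (f : X -> X) (A : {set X}) :
  \sum_(S : {set X} | S \subset A) cross_effect x0 f S =
    t (f \o retract x0 A).
Proof.
pose a (T : {set X}) : rat := (-1) ^+ #|T|.
pose g T := t (f \o retract x0 T).
transitivity (\sum_(T : {set X}) a T * g T *
    \sum_(S : {set X} | S \subset A) a S * (T \subset S)%:R).
  under eq_bigr => S _ do rewrite /cross_effect big_mkcond big_distrr /=.
  rewrite exchange_big; apply: eq_bigr => T _; rewrite big_distrr /=.
  apply: eq_bigr => S _; rewrite /a; case: ifP => _; rewrite ?mulr0 //.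
  by rewrite mulr1 mulrC.
rewrite (bigD1 A) //= (bigD1 A) //= big1 ?addr0; last first.
  move=> S /andP[SA neSA]; rewrite [_ \subset _]negbTE ?mulr0 //.
  by apply: contra neSA => AS; rewrite eqEsubset SA.
rewrite subxx mulr1 (mulrC (a A)) -mulrA -expr2 sqrr_sign mulr1.
rewrite big1 ?addr0 // => T neTA.
have [TA|nTA] := boolP (T \subset A); last first.
  rewrite big1 ?mulr0 // => S SA; rewrite [_ \subset _]negbTE ?mulr0 //.
  by apply: contra nTA => /subset_trans; apply.
have /subsetPn[y yA yT] : ~~ (A \subset T).
  by apply: contra neTA => AT; rewrite eqEsubset TA.
rewrite (alt_sum_eq0 yA) ?mulr0 // => S SA yS; congr (nat_of_bool _)%:R.
apply/idP/idP => [/subsetP TS|TS]; last exact: subset_trans (subsetUr _ _).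
apply/subsetP=> z zT; have := TS z zT; rewrite in_setU1.
by case: eqP => // zy; rewrite -zy zT in yT.
Qed.

Hypothesis t_tr : trace_like (@t).

(** If y in [S] leaves [S] or is not reached from [S], then y is a transient
    point of every f o retract T with T inside S, so collapsing it to the base
    point does not change t: the cyclic property removes it after one more
    application of the retraction, which t allows since retractions are
    idempotent. *)
Lemma cross_effect_unstable (X : finType) (x0 : X) f (S : {set X}) :
  f x0 = x0 -> x0 \notin S -> f @: S != S -> cross_effect x0 f S = 0.
Proof.
move=> fx0 x0S neS; rewrite /cross_effect.
have [y yS ny] : exists2 y, y \in S & (f y \notin S) || (y \notin f @: S).
  apply/exists_inP; apply: contraR neS; rewrite negb_exists_in => /forall_inP H.
  rewrite eqEsubset; apply/andP; split; apply/subsetP.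
    move=> _ /imsetP[z zS ->].
    by have := H z zS; rewrite negb_or !negbK => /andP[].
  by move=> z zS; have := H z zS; rewrite negb_or !negbK => /andP[].
rewrite (alt_sum_eq0 yS) ?mulr0 // => T TS yT.
pose r := retract x0.
have TT' : T :&: (y |: T) = T by apply/setIidPl/subsetUr.
have T'S : y |: T \subset S by rewrite subUset sub1set yS.
have x0T' : x0 \notin y |: T by apply: contra x0S => /(subsetP T'S).
have t_idem A : t (r A \o (f \o r A)) = t (f \o r A).
  rewrite (trace_cyc t_tr); apply: (trace_ext t_tr) => x /=; congr f.
  by have := retractI x0 A A x; rewrite setIid.
(* If f y is outside S, y is removed before f; if y is not in f(S), after f. *)
rewrite -[LHS]t_idem; case/orP: ny => [fyS|yfS].
  transitivity (t (r (y |: T) \o (f \o r T))).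
    apply: (trace_ext t_tr) => x /=.
    have [->|xy] := eqVneq x y;
      last by rewrite {2 4}/r /retract in_setU1 (negbTE xy).
    rewrite /r {2 4}/retract setU11 (negbTE yT) fx0.
    rewrite /retract (negbTE x0T') ifN //.
    by apply: contra fyS => /(subsetP T'S).
  rewrite (trace_cyc t_tr); apply: (trace_ext t_tr) => x /=; congr f.
  by have := retractI x0 T (y |: T) x; rewrite TT'.
transitivity (t (r T \o (f \o r (y |: T)))).
  apply: (trace_ext t_tr) => x /=; set z := f _.
  suff zy : z != y by rewrite /r /retract in_setU1 (negbTE zy).
  rewrite {}/z /r /retract; case: ifP => [/(subsetP T'S) xS|_].
    by apply: contraNneq yfS => <-; apply: imset_f.
  by rewrite fx0; apply: contraNneq x0S => ->.
rewrite (trace_cyc t_tr); apply: (trace_ext t_tr) => x /=; congr f.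
by have := retractI x0 (y |: T) T x; rewrite setIC TT'.
Qed.

(** Cross effects only see what happens on [S] and the base point: each map
    f o retract T factors through j, so cyclicity moves it to [Y]. *)
Lemma cross_effect_inj (X Y : finType) (x0 : X) (f : X -> X) (y0 : Y)
    (g : Y -> Y) (j : Y -> X) (S : {set Y}) :
    injective j -> j y0 = x0 -> g y0 = y0 -> y0 \notin S ->
    (forall y, f (j y) = j (g y)) ->
  cross_effect x0 f (j @: S) = cross_effect y0 g S.
Proof.
move=> j_inj jy0 gy0 y0S fj; rewrite /cross_effect card_imset //; congr (_ * _).
rewrite (reindex_onto (fun T : {set Y} => j @: T) (fun T => j @^-1: T)) /=;
  last first.
  move=> T /subsetP TS; apply/setP=> x; apply/imsetP/idP => [[y]|xT].
    by rewrite inE => yT ->.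
  by have /imsetP[y _ xE] := TS x xT; exists y; rewrite ?inE -?xE.
have jK (T : {set Y}) : j @^-1: (j @: T) = T.
  by apply/setP=> y; rewrite inE mem_imset.
apply: eq_big => [T|T TS].
  rewrite jK eqxx andbT; apply/idP/idP; last exact: imsetS.
  by move=> /(preimsetS j); rewrite !jK.
rewrite card_imset //; congr (_ * _).
(* A left inverse of j, sending what is outside the image to the base point. *)
pose rho x := odflt y0 [pick y | j y == x].
have rhoK y : rho (j y) = y.
  rewrite /rho; case: pickP => [z /eqP/j_inj -> //|/(_ y)].
  by rewrite eqxx.
transitivity (t (j \o (g \o retract y0 T \o rho))).
  apply: (trace_ext t_tr) => x /=; rewrite -fj; congr f.
  have [/existsP[y /eqP <-]|nx] := boolP [exists y, j y == x].
    by rewrite rhoK /retract mem_imset //; case: ifP.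
  have -> : rho x = y0.
    rewrite /rho; case: pickP => // y jy.
    by case/existsP: nx; exists y.
  rewrite /retract if_same jy0 ifN //.
  by apply: contra nx => /imsetP[y _ ->]; apply/existsP; exists y.
apply: etrans (trace_cyc t_tr (g \o retract y0 T \o rho) j) _.
by apply: (trace_ext t_tr) => y /=; rewrite rhoK.
Qed.
End CrossEffects.

Lemma cross_effect_degree K (t : endo_fun) (X : finType) (x0 : X) f
    (S : {set X}) :
  degree_le K t -> (K < #|S|)%N -> cross_effect t x0 f S = 0.
Proof.
move=> t_deg KS; rewrite /cross_effect.
rewrite (t_deg X X S (fun T => f \o retract x0 T) Some) ?mulr0 //.
move=> T y x _ _ yT.
have [->|xy] := eqVneq x y; rewrite ?eqxx //.
by rewrite /retract /= in_setU1 (negbTE xy).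
Qed.

(** * Counting equivariant maps *)
Definition fixpt (X : finType) (f : X -> X) (i : nat) : nat :=
  #|[set x | iter i f x == x]|.

(** The map f sends the fixed points of (gf)^i injectively to those of (fg)^i,
    and symmetrically.  For i = 0 both sides would be cardinals of the carriers,
    hence the hypothesis. *)
Lemma fixpt_cyc (X Y : finType) (f : X -> Y) (g : Y -> X) i :
  (0 < i)%N -> fixpt (g \o f) i = fixpt (f \o g) i.
Proof.
case: i => // i _.
have shift (A B : finType) (u : A -> B) (v : B -> A) n a :
  u (iter n (v \o u) a) = iter n (u \o v) (u a).
  by elim: n => //= n IHn; rewrite IHn.
have le (A B : finType) (u : A -> B) (v : B -> A) :
    (fixpt (v \o u) i.+1 <= fixpt (u \o v) i.+1)%N.
  have u_inj : {in [set x | iter i.+1 (v \o u) x == x] &, injective u}.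
    move=> a b; rewrite !inE => /eqP Ea /eqP Eb uab.
    by rewrite -Ea -Eb !iterSr /= uab.
  rewrite /fixpt -(card_in_imset u_inj); apply/subset_leq_card/subsetP.
  by move=> _ /imsetP[a + ->]; rewrite !inE -shift => /eqP ->.
by apply/eqP; rewrite eqn_leq !le.
Qed.

Definition equiv_count k (s : 'S_k) (X : finType) (f : X -> X) : rat :=
  #|[set h : {ffun 'I_k -> X} | [forall i, f (h i) == h (s i)]]|%:R.

Lemma equiv_count_sum k (s : 'S_k) (X : finType) (f : X -> X) :
  equiv_count s f =
    \sum_(h : {ffun 'I_k -> X}) [forall i, f (h i) == h (s i)]%:R.
Proof.
rewrite /equiv_count -sum1_card natr_sum big_mkcond; apply: eq_bigr => h _.
by rewrite inE; case: ifP.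
Qed.

Lemma froot_perm k (s : 'S_k) i : froot s (s i) = froot s i.
Proof.
apply/eqP; rewrite eq_sym root_connect ?fconnect1 //.
exact/fconnect_sym/perm_inj.
Qed.

(** An equivariant h is determined by its values on representatives of the
    cycles of s, and the value on a cycle of length c can be any x such that
    f^c x = x. *)
Lemma equiv_count_prod k (s : 'S_k) (X : finType) (f : X -> X) :
  equiv_count s f = \prod_(i in froots s) (fixpt f (fingraph.order s i))%:R.
Proof.
have s_inj := @perm_inj _ s; have s_sym := fconnect_sym s_inj.
pose R := {i : 'I_k | i \in froots s}.
pose F (j : R) : pred X := [pred x | iter (fingraph.order s (val j)) f x == x].
pose E := [set h : {ffun 'I_k -> X} | [forall i, f (h i) == h (s i)]].
pose res (h : {ffun 'I_k -> X}) : {ffun R -> X} := [ffun j => h (val j)].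
have E_iter h i n : h \in E -> h (iter n s i) = iter n f (h i).
  rewrite inE => /forallP hE; elim: n => //= n <-.
  by rewrite (eqP (hE _)).
have root_ok i : froot s i \in froots s by apply: roots_root.
pose rt i : R := exist (fun i => i \in froots s) (froot s i) (root_ok i).
have idxK i : iter (findex s (froot s i) i) s (froot s i) = i.
  by apply: iter_findex; rewrite s_sym connect_root.
have res_inj : {in E &, injective res}.
  move=> h h' hE h'E /ffunP eqr; apply/ffunP=> i.
  rewrite -(idxK i) !E_iter //; congr iter.
  by have := eqr (rt i); rewrite !ffunE.
have resE : res @: E = [set g in family F].
  apply/setP=> g; rewrite inE; apply/imsetP/familyP => [[h hE -> j]|gF].
    by rewrite ffunE inE -E_iter // iter_order.
  exists [ffun i => iter (findex s (froot s i) i) f (g (rt i))].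
    rewrite inE; apply/forallP=> i; rewrite !ffunE.
    have -> : rt (s i) = rt i by apply/val_inj/froot_perm.
    rewrite froot_perm.
    set r := froot s i; set d := findex s r i.
    have si : iter d.+1 s r = s i by rewrite iterS idxK.
    (* Position of s i on its cycle: d + 1, or 0 when d + 1 closes the cycle. *)
    have : (d < fingraph.order s r)%N.
      by apply: findex_max; rewrite s_sym connect_root.
    rewrite leq_eqVlt => /orP[/eqP dE|dlt];
      last by rewrite -si findex_iter.
    have := gF (rt i); rewrite inE /= -/r -dE /= => /eqP ->.
    by rewrite -si dE iter_order // findex0.
  apply/ffunP=> -[i ri]; rewrite !ffunE /=.
  have Ei : rt i = exist _ i ri by apply/val_inj/eqP.
  by rewrite Ei (eqP ri) findex0.
rewrite /equiv_count -(card_in_imset res_inj) resE cardsE card_family.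
rewrite foldrE big_image /= natr_prod [RHS]big_sub.
by apply: eq_bigr => j _; rewrite /fixpt cardsE.
Qed.

Lemma equiv_count_trace_like k (s : 'S_k) : trace_like (@equiv_count k s).
Proof.
split=> [X f g fg|X Y f g].
  rewrite !equiv_count_sum; apply: eq_bigr => h _.
  by congr (nat_of_bool _)%:R; apply: eq_forallb => i; rewrite fg.
rewrite !equiv_count_prod; apply: eq_bigr => i _.
by rewrite fixpt_cyc ?order_gt0.
Qed.

(** For a fixed h, the alternating sum over [T] cancels if h misses a point of
    [S].  Otherwise h is a bijection onto [S], as |S| >= k, and only [T] = [S]
    contributes: a point of [S] outside [T] would be sent by f to x0, which is
    not a value of h. *)
Lemma cross_effect_equiv_count k (s : 'S_k) (X : finType) (x0 : X)
    (f : X -> X) (S : {set X}) :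
    f x0 = x0 -> x0 \notin S -> (k <= #|S|)%N ->
  cross_effect (@equiv_count k s) x0 f S =
    \sum_(h : {ffun 'I_k -> X} | h @: setT == S)
      [forall i, f (h i) == h (s i)]%:R.
Proof.
move=> fx0 x0S kS; rewrite /cross_effect.
pose b (h : {ffun 'I_k -> X}) T : rat :=
  [forall i, f (retract x0 T (h i)) == h (s i)]%:R.
transitivity ((-1) ^+ #|S| * \sum_(h : {ffun 'I_k -> X})
    \sum_(T : {set X} | T \subset S) (-1) ^+ #|T| * b h T).
  congr (_ * _); rewrite exchange_big; apply: eq_bigr => T _.
  by rewrite -big_distrr /= equiv_count_sum.
rewrite big_distrr [RHS]big_mkcond; apply: eq_bigr => h _ /=.
case: ifP => [/eqP hS|nhS]; last first.
  have /subsetPn[y yS yh] : ~~ (S \subset h @: setT).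
    apply: contraFN nhS => Sh; rewrite eq_sym eqEcard Sh /=.
    apply: leq_trans kS.
    by rewrite -[k in (_ <= k)%N]card_ord -cardsT leq_imset_card.
  rewrite (alt_sum_eq0 yS) ?mulr0 // => T _ yT; congr (nat_of_bool _)%:R.
  apply: eq_forallb => i; congr (f _ == _); rewrite /retract in_setU1.
  by case: eqP => // hy; rewrite -hy imset_f ?inE in yh.
rewrite (bigD1 S) //= big1 ?addr0 => [|T /andP[TS neTS]].
  rewrite mulrA -expr2 sqrr_sign mul1r; congr (nat_of_bool _)%:R.
  by apply: eq_forallb => i; rewrite /retract -hS imset_f ?inE.
have /subsetPn[y yS yT] : ~~ (S \subset T).
  by apply: contra neTS => ST; rewrite eqEsubset TS.
move: yS; rewrite -hS => /imsetP[i _ yi].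
rewrite /b [X in nat_of_bool X]negbTE ?mulr0 // negb_forall.
apply/existsP; exists i; rewrite /retract -yi (negbTE yT) fx0.
by apply: contraNneq x0S => ->; rewrite -hS imset_f ?inE.
Qed.

Lemma card_onto_ffuns k (X : finType) (S : {set X}) : #|S| = k ->
  #|[set h : {ffun 'I_k -> X} | h @: setT == S]| = k`!.
Proof.
move=> cS; have -> : k`! = (#|S| ^_ #|'I_k|)%N by rewrite cS card_ord ffactnn.
rewrite -card_inj_ffuns_on; apply: eq_card => h; rewrite !inE.
apply/idP/andP => [/eqP hS|[/ffun_onP hS /injectiveP h_inj]].
  split; first by apply/ffun_onP=> i; rewrite -hS imset_f ?inE.
  apply/injectiveP=> i j; apply: (imset_injP _) => //.
  by rewrite hS cS cardsT card_ord.
rewrite eqEcard card_imset // cardsT card_ord cS leqnn andbT.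
by apply/subsetP=> _ /imsetP[i _ ->].
Qed.

(** The model of a pointed set on which s acts is [option 'I_k], with base point
    [None]; [h] identifies it with [S] and x0. *)
Lemma cross_effect_perm k (t : endo_fun) (s : 'S_k)
    (X : finType) (x0 : X) f (S : {set X}) (h : {ffun 'I_k -> X}) :
    trace_like t -> f x0 = x0 -> x0 \notin S -> injective h -> h @: setT = S ->
    (forall i, f (h i) = h (s i)) ->
  cross_effect t x0 f S = cross_effect t None (omap s) [set~ None].
Proof.
move=> t_tr fx0 x0S h_inj hS fh.
have h_x0 i : h i != x0.
  by apply: contraNneq x0S => <-; rewrite -hS imset_f ?inE.
pose j (o : option 'I_k) := if o is Some i then h i else x0.
have -> : S = j @: [set~ None].
  rewrite -hS; apply/setP=> x; apply/imsetP/imsetP => [[i _ ->]|[[i|]]].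
  - by exists (Some i); rewrite ?inE.
  - by move=> _ ->; exists i; rewrite ?inE.
  by rewrite !inE.
apply: cross_effect_inj => //; rewrite ?inE ?eqxx //; last by case.
case=> [a|] [b|] //= => [/h_inj -> //|/eqP|/esym/eqP];
  by rewrite (negbTE (h_x0 _)).
Qed.

Lemma perm_of_stable k (X : finType) (f : X -> X) (S : {set X})
    (h : {ffun 'I_k -> X}) : injective h -> h @: setT = S -> f @: S = S ->
  exists s : 'S_k, forall i, f (h i) = h (s i).
Proof.
move=> h_inj hS fS.
have hP x : x \in S -> {i | h i == x}.
  move=> xS; apply: sigW; move: xS; rewrite -hS => /imsetP[i _ ->].
  by exists i; apply/eqP.
have fhS i : f (h i) \in S by rewrite -fS imset_f // -hS imset_f ?inE.
pose g i := sval (hP _ (fhS i)).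
have gE i : h (g i) = f (h i) by apply/eqP; apply: (svalP (hP _ (fhS i))).
have f_inj : {in S &, injective f} by apply/imset_injP; rewrite fS.
have g_inj : injective g.
  move=> a b /(congr1 h); rewrite !gE => /f_inj E; apply/h_inj/E.
    by rewrite -hS imset_f ?inE.
  by rewrite -hS imset_f ?inE.
by exists (perm g_inj) => i; rewrite permE gE.
Qed.

Lemma cross_effect_sub_sum (J : finType) (c : J -> rat)
    (t : endo_fun) (u : J -> endo_fun) (X : finType) (x0 : X) f (S : {set X}) :
  cross_effect (fun X f => t X f - \sum_j c j * u j X f) x0 f S =
    cross_effect t x0 f S - \sum_j c j * cross_effect (u j) x0 f S.
Proof.
rewrite /cross_effect; under eq_bigr => T _ do rewrite mulrBr.
rewrite sumrB mulrBr; congr (_ - _).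
under eq_bigr => T _ do rewrite big_distrr /=.
rewrite exchange_big big_distrr; apply: eq_bigr => j _ /=.
rewrite mulrCA; congr (_ * _); rewrite big_distrr.
by apply: eq_bigr => T _; rewrite mulrCA.
Qed.

(** * Polynomiality *)

(** Induction on the bound [k] on the size of nonzero cross effects.  Every
    bijection h from k points onto a set [S] permuted by f conjugates f|S to one
    permutation s, so the sum over s of w(s) N_s has cross effect k! w(f, S) at
    [S]; dividing by k! and subtracting from t lowers the bound. *)
Lemma pointed_poly N k (t : endo_fun) :
    (k <= N.+1)%N -> trace_like t ->
    (forall (X : finType) (x0 : X) f (S : {set X}),
       f x0 = x0 -> x0 \notin S -> (k <= #|S|)%N ->
       cross_effect t x0 f S = 0) ->
  exists phi : {mpoly rat[N.+1]}, forall (X : finType) (x0 : X) f,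
    f x0 = x0 -> t X f = phi.@[fun i => (fixpt f i)%:R].
Proof.
elim: k t => [|k IHk] t kN t_tr t0.
  exists 0 => X x0 f fx0; rewrite raddf0.
  transitivity (t X (f \o retract x0 [set~ x0])).
    apply: (trace_ext t_tr) => x; rewrite /retract /= !inE.
    by case: eqP => // ->.
  rewrite -cross_effect_sum big1 // => S /subsetP Sx0; apply: t0 => //.
  by apply/negP=> /Sx0; rewrite !inE eqxx.
pose c (s : 'S_k) := cross_effect t None (omap s) [set~ None] / k`!%:R.
pose t' X f := t X f - \sum_s c s * equiv_count s f.
have t'_tr : trace_like t'.
  split=> [X f g fg|X Y f g]; rewrite /t'.
    rewrite (trace_ext t_tr fg); congr (_ - _); apply: eq_bigr => s _.
    by rewrite (trace_ext (equiv_count_trace_like s) fg).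
  rewrite (trace_cyc t_tr); congr (_ - _); apply: eq_bigr => s _.
  by rewrite (trace_cyc (equiv_count_trace_like s)).
have [X x0 f S fx0 x0S kS|phi phiE] := IHk t' (ltnW kN) t'_tr.
  rewrite cross_effect_sub_sum; apply/eqP; rewrite subr_eq0; apply/eqP.
  under [RHS]eq_bigr => s _ do rewrite cross_effect_equiv_count //.
  have [cS|neS] := eqVneq #|S| k; last first.
    rewrite t0 // 1?ltn_neqAle 1?eq_sym ?neS // big1 // => s _.
    rewrite big1 ?mulr0 // => h /eqP hS; case/negP: neS.
    rewrite eqn_leq kS andbT -hS -[k in (_ <= k)%N]card_ord -cardsT.
    exact: leq_imset_card.
  under eq_bigr => s _ do rewrite big_distrr /=.
  rewrite exchange_big /=.
  rewrite (eq_bigr (fun=> cross_effect t x0 f S / k`!%:R)).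
    rewrite -big_set sumr_const (card_onto_ffuns cS) -[RHS]mulr_natr divfK //.
    by rewrite pnatr_eq0 -lt0n fact_gt0.
  move=> h /eqP hS.
  have h_inj : injective h.
    move=> i j; apply: (imset_injP _) => //.
    by rewrite hS cS cardsT card_ord.
  (* The coefficient c s may be replaced by its value at S wherever h conjugates
     f to s; the remaining sum over s counts these permutations. *)
  have cE s : c s * [forall i, f (h i) == h (s i)]%:R =
      cross_effect t x0 f S / k`!%:R * [forall i, f (h i) == h (s i)]%:R.
    case: forallP => [hs|_]; last by rewrite !mulr0.
    by rewrite /c -(cross_effect_perm t_tr fx0 x0S h_inj hS) // => i; apply/eqP.
  under eq_bigr => s _ do rewrite cE.
  have [fS|nfS] := eqVneq (f @: S) S; last first.
    by rewrite cross_effect_unstable // mul0r big1 // => s _; rewrite mul0r.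
  have [s hs] := perm_of_stable h_inj hS fS.
  rewrite (bigD1 s) //= big1 => [|s' nes].
    by rewrite addr0; case: forallP => [_|[] i]; rewrite ?mulr1 // hs.
  case: forallP => [hs'|_]; last by rewrite mulr0.
  case/eqP: nes; apply/permP=> i; apply: h_inj.
  by rewrite -hs; apply/esym/eqP.
exists (phi + \sum_s
  c s *: \prod_(i in froots s) 'X_(inord (fingraph.order s i))).
move=> X x0 f fx0; rewrite mevalD -(phiE _ _ _ fx0) /t'.
rewrite -[LHS](subrK (\sum_s c s * equiv_count s f)).
congr (_ + _); rewrite raddf_sum; apply: eq_bigr => s _ /=.
rewrite mevalZ equiv_count_prod rmorph_prod; congr (_ * _).
apply: eq_bigr => i _ /=.
rewrite mevalXU inordK // (leq_ltn_trans _ (kN : k < N.+1)%N) //.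
by rewrite -[k in (_ <= k)%N]card_ord max_card.
Qed.

(** The points of [T] are fixed; those of [Y] outside [T] behave like x0. *)
Definition adjoin (X Y : finType) (f : X -> X) (x0 : X) (T : {set Y})
    (z : X + Y) : X + Y :=
  match z with
  | inl x => inl (f x)
  | inr y => if y \in T then inr y else inl (f x0)
  end.

Lemma fixpt_adjoin (X Y : finType) (f : X -> X) (x0 : X) (T : {set Y}) i :
  fixpt (adjoin f x0 T) i = (fixpt f i + if i == 0 then #|Y| else #|T|)%N.
Proof.
have inlE n x : iter n (adjoin f x0 T) (inl x) = inl (iter n f x).
  by elim: n => //= n ->.
rewrite /fixpt -!sum1dep_card big_sumType /=; congr (_ + _)%N.
  by apply: eq_bigl => x; rewrite inlE.
case: i => [|i]; first by rewrite -sum1_card; apply: eq_bigl => y; rewrite eqxx.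
rewrite [RHS]/= -sum1_card; apply: eq_bigl => y; rewrite iterSr /=.
case: ifP => yT; last by rewrite inlE.
by rewrite iter_fix ?eqxx //= yT.
Qed.

(** The relation obtained by adjoining K + 1 points expresses t(f), the term of
    the empty set, through maps with a fixed point in [Y]; these have
    a_i = a_i(f) + |T| for i > 0 and a_0 = a_0(f) + |Y|. *)
Lemma trace_poly K (t : endo_fun) :
    trace_like t -> degree_le K t ->
  exists phi : {mpoly rat[K.+1]}, forall (X : finType) (f : X -> X),
    (0 < #|X|)%N -> t X f = phi.@[fun i => (fixpt f i)%:R].
Proof.
move=> t_tr t_deg.
have [X x0 f S fx0 x0S KS|phi phiE] := pointed_poly (leqnn K.+1) t_tr.
  exact: cross_effect_degree t_deg KS.
pose Y : finType := 'I_K.+1.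
(* The substitution of variables that computes the a_i of the extended map. *)
pose shift (T : {set Y}) : (K.+1).-tuple {mpoly rat[K.+1]} :=
  [tuple ('X_i + (if val i == 0 then #|Y| else #|T|)%:R%:MP) | i < K.+1].
exists (- \sum_(T : {set Y} | T != set0) (-1) ^+ #|T| *: (phi \mPo shift T)).
move=> X f /card_gt0P[x0 _].
have := t_deg (X + Y)%type Y setT (adjoin f x0)
  (fun z => if z is inr y then Some y else None).
rewrite (eq_bigl predT) => [|T]; last by rewrite subsetT.
rewrite (bigD1 set0) //= cards0 expr0 mul1r => E.
have {E} : t (X + Y)%type (adjoin f x0 set0) +
    \sum_(T : {set Y} | T != set0)
      (-1) ^+ #|T| * t (X + Y)%type (adjoin f x0 T) = 0.
  apply: E => [T y [x|y'] _ _ yT //=|]; last by rewrite cardsT card_ord.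
  by move=> neq; rewrite in_setU1 [y' == y]negbTE //;
    apply: contraNneq neq => ->.
have -> : t (X + Y)%type (adjoin f x0 set0) = t X f.
  pose r (z : X + Y) := if z is inl x then x else x0.
  rewrite (trace_ext t_tr (g := inl \o (f \o r))); last first.
    by case=> //= y; rewrite inE.
  by rewrite (trace_cyc t_tr); apply: (trace_ext t_tr).
move/eqP; rewrite addr_eq0 => /eqP ->; rewrite mevalN; congr (- _).
rewrite raddf_sum; apply: eq_bigr => T /set0Pn[y yT].
rewrite /= mevalZ comp_mpoly_meval (phiE _ (inr y)) /= ?yT //.
congr (_ * _); apply: meval_eq => i.
by rewrite fixpt_adjoin tnth_mktuple mevalD mevalXU mevalC natrD.
Qed.

Theorem corollary5p10 (V : Frep) (V_fg : finitely_generated V) :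
  (exists p : {poly rat}, forall n : nat, (0 < n)%N ->
     (\dim {:V n})%:R = p.[n%:R])
  /\ (exists (N : nat) (phi : {mpoly rat[N]}), universal_trace_poly V phi)
  /\ (forall (N : nat) (phi : {mpoly rat[N]}), universal_trace_poly V phi ->
        forall n : nat, (0 < n)%N ->
          (\dim {:V n})%:R = phi.@[fun _ : 'I_N => n%:R]).
Proof.
have dimE N (phi : {mpoly rat[N]}) : universal_trace_poly V phi ->
    forall n, (0 < n)%N -> (\dim {:V n})%:R = phi.@[fun _ : 'I_N => n%:R].
  move=> phiP n n_gt0; rewrite -lftrace_id -Fmap_id phiP //.
  apply: meval_eq => -[[|i] iN] //=; congr _%:R.
  rewrite /nfix -[RHS]card_ord -cardsT; apply: eq_card => x.
  rewrite !inE; apply/eqP.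
  by rewrite iter_fix //= !ffunE.
have [N [phi phiP]] :
    exists N (phi : {mpoly rat[N]}), universal_trace_poly V phi.
  have [ks V_quot] := V_fg; pose K := \max_(k <- ks) k.
  have ksK : {in ks, forall k, k <= K}%N.
    by move=> k kks; rewrite /K (big_rem k) //= leq_maxl.
  have [phi phiE] :=
    trace_poly (frep_trace_like V) (frep_trace_degree_le V_quot ksK).
  exists K.+1, phi => n f n_gt0; rewrite -frep_trace_ord phiE ?card_ord //.
  apply: meval_eq => -[[|i] iK] //=; congr _%:R.
  rewrite /fixpt -[RHS]card_ord -cardsT; apply: eq_card => x.
  by rewrite !inE eqxx.
split; last by split; [exists N, phi | exact: dimE].
exists (mmap polyC (fun _ => 'X) phi) => n n_gt0; rewrite (dimE _ _ phiP) //.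
rewrite mevalE /mmap horner_sum; apply: eq_bigr => m _.
rewrite hornerM hornerC; congr (_ * _); rewrite /mmap1 horner_prod.
by apply: eq_bigr => i _; rewrite hornerXn.
Qed.
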